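(* Let $T$ be a countably infinite tree with at most one pendant vertex (vertex of degree $1$). Then $D_e(T) = 2$.
   Context: An endomorphism of a simple graph $G=(V,E)$ is a map $\phi: V\to V$ such that $\phi(u)\phi(v)\in E$ whenever $uv\in E$. A labeling $c$ of $V$ is preserved by $\phi$ if $c(\phi(v))=c(v)$ for all $v$. The endomorphism distinguishing number $D_e(G)$ is the least cardinal $d$ such that $G$ has a labeling with $d$ labels preserved only by the identity endomorphism. *)

(* Defs.v *)
From mathcomp Require Import all_boot.
From mathcomp Require Import mathcomp_extra boolp classical_sets functions cardinality.

Set Implicit Arguments.
Unset Strict Implicit.
Unset Printing Implicit Defensive.

Local Open Scope classical_set_scope.
Local Open Scope card_scope.

(* Adjacency is boolean only so that [path] and [ucycle] apply: in the
   classical setting of [boolp] this is no restriction on the graph. *)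
Record sgraph (V : eqType) := SGraph {
  adj : rel V;
  adj_sym : symmetric adj;
  adj_irrefl : irreflexive adj }.

Definition neighbors (V : eqType) (G : sgraph V) (v : V) : set V :=
  [set u | adj G v u].

Definition pendant (V : eqType) (G : sgraph V) (v : V) : Prop :=
  neighbors G v #= `I_1.

Definition connected_graph (V : eqType) (G : sgraph V) : Prop :=
  forall u v : V, exists2 p : seq V, path (adj G) u p & last u p = v.

(* [ucycle] also accepts the empty cycle and a single edge u, v traversed back
   and forth; the cycles of graph theory have at least 3 vertices. *)
Definition acyclic_graph (V : eqType) (G : sgraph V) : Prop :=
  forall p : seq V, 3 <= size p -> ~ ucycle (adj G) p.

Definition tree (V : eqType) (G : sgraph V) : Prop :=
  connected_graph G /\ acyclic_graph G.

Definition endomorphism (V : eqType) (G : sgraph V) (phi : V -> V) : Prop :=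
  {homo phi : u v / adj G u v}.

Definition preserves (V L : Type) (phi : V -> V) (c : V -> L) : Prop :=
  forall v, c (phi v) = c v.

Definition endo_distinguishing (V : eqType) (L : Type) (G : sgraph V)
    (c : V -> L) : Prop :=
  forall phi : V -> V, endomorphism G phi -> preserves phi c -> phi =1 id.

(* D_e(G) = |L|.  The graph may be infinite, so D_e(G) is a cardinal; a
   cardinal is represented by a type of labels L having that cardinality. *)
Definition De_eq (V : eqType) (G : sgraph V) (L : Type) : Prop :=
  (exists c : V -> L, endo_distinguishing G c) /\
  (forall L' : Type, (exists c : V -> L', endo_distinguishing G c) ->
    [set: L] #<= [set: L']).

(* Main.v *)
(** Root the tree so that every vertex has a child.  Color by depth with the
    8-periodic word 10011000, and flip the color of a sparse set of marked
    vertices, at most one per level, all at depths congruent to 6 modulo 8,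
    such that every vertex has a marked descendant.  A finite computation shows
    that the color sequence of a descending ray from the root cannot be read
    along a walk that ever goes up, nor along one that starts at a depth that
    is not divisible by 8.  Hence a color-preserving endomorphism shifts all
    depths by a constant; the growing gaps between the marked levels force this
    constant to be 0, so the marked vertices and then all their ancestors are
    fixed. *)
Require Import Defs.
From mathcomp Require Import all_boot.
From mathcomp Require Import mathcomp_extra boolp classical_sets functions cardinality.

Local Open Scope classical_set_scope.

(** * Rooting a tree so that every vertex has a child *)

Lemma unique_simple_path (V : eqType) (T : sgraph V) (r : V) (p q : seq V) :
  acyclic_graph T -> path (adj T) r p -> uniq (r :: p) ->
  path (adj T) r q -> uniq (r :: q) -> last r p = last r q -> p = q.
Proof.
move=> acT; elim: p r q => [|x p IHp] r [|y q] //.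
- move=> _ _ _ /= /andP[rq _] e; move: rq.
  by rewrite e mem_last.
- move=> _ /= /andP[rp _] _ _ e; move: rp.
  by rewrite -e mem_last.
move=> /= /andP[rx pp] /andP[rNp up] /andP[ry pq] /andP[rNq uq] elast.
have [exy|xNy] := eqVneq x y.
  by rewrite -exy in pq uq elast *; rewrite (IHp x q).
(* If the first steps differ, following [p] and then [q] backwards leads from [x] to [y] avoiding
   [r]; shortened to a simple path and closed through [r], it is a cycle. *)
exfalso; pose s := p ++ rev (belast y q).
have ps : path (adj T) x s.
  rewrite cat_path pp elast rev_path /=.
  by under eq_path => u v do rewrite adj_sym.
have ls : last x s = y.
  rewrite last_cat elast; case: {+}q => [|z q'] //=.
  by rewrite rev_cons last_rcons.
have rNs : r \notin x :: s.
  rewrite -cat_cons mem_cat negb_or rNp mem_rev.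
  by apply: contra rNq => /mem_belast.
case: (shortenP ps) ls => s' ps' us' ss' ls'.
have rNs' : r \notin x :: s'.
  apply: contra rNs; rewrite !inE => /orP[->//|/ss' ->].
  by rewrite orbT.
apply: (acT [:: r, x & s']).
  by case: (s') ls' => [/= exy|//]; rewrite exy eqxx in xNy.
rewrite /ucycle /= rcons_path rx ps' ls' /= adj_sym ry /=.
by rewrite rNs'.
Qed.

(** The root is its own parent, which is why [depth_parent] and [adj_parentE] exclude it. *)
Record rooting (V : eqType) (T : sgraph V) (r : V) := Rooting {
  depth : V -> nat;
  parent : V -> V;
  depth_eq0 : forall v, (depth v == 0) = (v == r);
  parent_root : parent r = r;
  depth_parent : forall v, v != r -> depth v = (depth (parent v)).+1;
  adj_parentE : forall u v, adj T u v =
    (v != r) && (parent v == u) || (u != r) && (parent u == v) }.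

Arguments rooting {V} T r.
Arguments depth {V T r} R _ : rename.
Arguments parent {V T r} R _ : rename.
Arguments depth_eq0 {V T r} R v : rename.
Arguments depth_parent {V T r} R v _ : rename.
Arguments parent_root {V T r} R : rename.
Arguments adj_parentE {V T r} R u v : rename.

Lemma tree_rooting (V : eqType) (T : sgraph V) (r : V) :
  tree T -> inhabited (rooting T r).
Proof.
move=> [conT acT].
have /choice[P PP] : forall v, exists p,
    [/\ path (adj T) r p, uniq (r :: p) & last r p = v].
  move=> v; have [p pp <-] := conT r v.
  by case: (shortenP pp) => p' ? ? _; exists p'.
have PE v p : path (adj T) r p -> uniq (r :: p) -> last r p = v -> P v = p.
  by move=> pp up lp; have [? ? ?] := PP v; apply: (unique_simple_path V T r);
    rewrite // lp.
have Pr : P r = [::] by apply: PE.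
have P_rcons u v : adj T u v -> v \notin r :: P u -> P v = rcons (P u) v.
  have [pu uu lu] := PP u => uv vNu; apply: PE.
  - by rewrite rcons_path pu lu.
  - by rewrite -rcons_cons rcons_uniq vNu.
  - by rewrite last_rcons.
have P_split u v : adj T u v -> v \in r :: P u -> P u = rcons (P v) u.
  have [pu uu lu] := PP u => uv vu.
  case/splitPl: vu pu uu lu => p1 p2 l1.
  rewrite cat_path last_cat l1 -cat_cons cat_uniq => /andP[pp1 pp2].
  move=> /and3P[up1 hp up2] lp2.
  have -> : P v = p1 by apply: PE.
  case: p2 pp2 hp up2 lp2 => [|x p2] pp2 hp up2 lp2.
    by move: lp2 uv => /= <-; rewrite adj_irrefl.
  case: p2 pp2 hp up2 lp2 => [|y p2] pp2 hp up2 lp2.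
    by rewrite -lp2 cats1.
  (* If at least two steps separate [v] from [u] on the path to [u], the edge [uv] closes that
     segment into a cycle. *)
  exfalso; apply: (acT [:: v, x, y & p2]) => //.
  rewrite /ucycle (cycle_path v) /= -/(last y p2).
  have vNp : v \notin [:: x, y & p2].
    by apply: (contra _ hp) => vp; apply/hasP; exists v; rewrite // -l1 mem_last.
  move: lp2 => /= ->; move: pp2 => /= ->; rewrite uv /=.
  by rewrite vNp.
(* The vertex before [v] on the path from [r]; for [v = r] the default of [last] gives [r]. *)
pose par v := last r (belast r (P v)).
have parE u v : P v = rcons (P u) v -> par v = u.
  move=> e; rewrite /par e belast_rcons /=.
  by have [_ _] := PP u; case: (P u).
have step v : v != r -> P v = rcons (P (par v)) v /\ adj T (par v) v.
  have [pv uv lv] := PP v => vr.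
  case/lastP E: (P v) pv uv lv => [|p x]; first by move=> _ _ /= e; rewrite e eqxx in vr.
  rewrite rcons_path -rcons_cons rcons_uniq last_rcons => /andP[pp ax] /andP[_ up] xv.
  have Pl : P (last r p) = p by apply: PE.
  have -> : par v = last r p by apply: parE; rewrite E Pl xv.
  by rewrite Pl -xv.
exists; apply: (@Rooting _ _ _ (size \o P) par).
- move=> v /=; rewrite size_eq0; apply/eqP/eqP => [e|->//].
  by have [_ _ <-] := PP v; rewrite e.
- by rewrite /par Pr.
- by move=> v /step[/= -> _]; rewrite size_rcons.
move=> u v; apply/idP/orP => [uv|[/andP[vr /eqP <-]|/andP[ur /eqP <-]]]; last first.
- by rewrite adj_sym; have [] := step u ur.
- by have [] := step v vr.
have rcons_neq x y : P y = rcons (P x) y -> y != r.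
  by move=> e; apply/eqP => yr; move: e; rewrite yr Pr; case: (P x).
have [vu|vNu] := boolP (v \in r :: P u).
  by right; have e := P_split u v uv vu; rewrite (parE _ _ e) eqxx (rcons_neq _ _ e).
by left; have e := P_rcons u v uv vNu; rewrite (parE _ _ e) eqxx (rcons_neq _ _ e).
Qed.

(** The root is the pendant vertex, if there is one. A childless vertex other than the root has only
    its parent as neighbor, hence is pendant; a childless root would be isolated. *)
Lemma root_with_children (V : eqType) (T : sgraph V) :
  infinite_set [set: V] -> tree T -> is_subset1 [set v | pendant T v] ->
  exists r, exists R : rooting T r,
    exists ch : V -> V, forall v, ch v != r /\ parent R (ch v) = v.
Proof.
move=> infV treeT pend1.
have [x0 _] : [set: V] !=set0.
  by apply/set0P/eqP => V0; apply: infV; rewrite V0; apply: finite_set0.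
have [r rP] : exists r, forall v, pendant T v -> v = r.
  have [[r pr]|noP] := pselect (exists r, pendant T r).
    by exists r => v pv; apply: pend1.
  by exists x0 => v pv; case: noP; exists v.
have [R] := tree_rooting V T r treeT.
exists r, R.
suff /choice[ch chP] : forall v, exists u, u != r /\ parent R u = v by exists ch.
move=> v; apply: contrapT => noch.
have nbrE u : adj T v u -> v != r /\ u = parent R v.
  rewrite (adj_parentE R) => /orP[/andP[ur /eqP uv]|/andP[vr /eqP]//].
  by case: noch; exists u.
have [y yv] : exists y, y != v.
  apply: contrapT => noy; apply: infV.
  suff -> : [set: V] = [set v] by apply: finite_set1.
  apply/seteqP; split=> [y _|//] /=; apply: contrapT => /eqP yv.
  by apply: noy; exists y.
have [p pp lp] := treeT.1 v y.
case: p pp lp => [_ /= e|x p /= /andP[vx _] _]; first by rewrite e eqxx in yv.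
have [vr xE] := nbrE x vx.
move/eqP: vr; apply; apply: rP; rewrite /pendant.
suff -> : neighbors T v = [set x] by apply: card_set1.
apply/seteqP; split=> [u|u] /=; last by move=> ->.
by move=> /nbrE[_ ->].
Qed.

(** * The finite computation on types *)

(* A vertex type is the depth modulo 8 together with the mark. *)
Definition type_color (t : nat * bool) : bool :=
  nth false [:: true; false; false; true; true; false; false; false] t.1 (+) t.2.

Definition types : seq (nat * bool) :=
  [seq (p, false) | p <- iota 0 8] ++ [:: (6, true)].

Definition below (s t : nat * bool) : bool := t.1 == s.1.+1 %% 8.

(** One round of pruning: iterating it leaves the pairs that start ever longer matched runs. *)
Definition trim (W : seq ((nat * bool) * (nat * bool))) :=
  [seq s <- W | has (fun t => below s.1 t.1 && (below s.2 t.2 || below t.2 s.2)) W].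

(* Pairs of types (of v, of phi v) for which a descent of n steps from v can be
   matched in color by a walk from phi v. *)
Definition viable (n : nat) :=
  iter n trim
    [seq s <- [seq (s, t) | s <- types, t <- types] | type_color s.1 == type_color s.2].

(* The iteration becomes stationary at n = 11. *)
Lemma viable_root :
  all (fun s => (s.1.1 == 0) ==> (s.2.1 == 0)) (viable 11).
Proof. by vm_compute. Qed.

(** Meant for the pairs [s] at a parent and [t] at its child: once the phases agree at the parent,
    the image of the child cannot lie above that of the parent. *)
Lemma viable_no_turn :
  all (fun s => all (fun t =>
    ~~ [&& s.1.1 == s.2.1, below s.1 t.1 & below t.2 s.2]) (viable 11)) (viable 11).
Proof. by vm_compute. Qed.

(** Within one phase the color reveals the mark, so marks are preserved once phases are. *)
Lemma types_color_inj s t :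
  s \in types -> t \in types -> s.1 = t.1 -> type_color s = type_color t -> s = t.
Proof.
have: all (fun s => all (fun t => [&& s.1 == t.1 & type_color s == type_color t] ==> (s == t)) types) types.
  by vm_compute.
move=> /allP H /H /allP {}H /H + e1 e2.
by rewrite e1 e2 !eqxx => /eqP.
Qed.

(** * Rigidity of the coloring of a rooted tree *)

Section LevelColoring.
Variables (V : eqType) (T : sgraph V) (r : V) (R : rooting T r) (ch : V -> V).
Hypothesis chP : forall v, ch v != r /\ parent R (ch v) = v.
Notation h := (depth R).
Notation par := (parent R).

Lemma depth_root : h r = 0.
Proof. by apply/eqP; rewrite depth_eq0. Qed.

Lemma depth_child v : h (ch v) = (h v).+1.
Proof. by have [chr chv] := chP v; rewrite (depth_parent R) // chv. Qed.

Lemma adj_child v : adj T v (ch v).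
Proof. by have [chr chv] := chP v; rewrite (adj_parentE R) chr chv eqxx. Qed.

Lemma depth_iter_child n v : h (iter n ch v) = n + h v.
Proof. by elim: n => //= n IHn; rewrite depth_child IHn. Qed.

Lemma iter_parent_child n v : iter n par (iter n ch v) = v.
Proof. by elim: n => //= n IHn; rewrite -iterS iterSr /= (chP _).2. Qed.

Lemma depth_ind (P : V -> Prop) :
  P r -> (forall v, v != r -> P (par v) -> P v) -> forall v, P v.
Proof.
move=> Pr Ps v; move: {2}(h v) (erefl (h v)) => n; elim: n v => [|n IHn] v hv.
  by have /eqP -> : v == r by rewrite -(depth_eq0 R) hv.
have vr : v != r by rewrite -(depth_eq0 R) hv.
by apply: Ps => //; apply: IHn; move: hv; rewrite (depth_parent R) // => -[].
Qed.

(** Parity of depth folds the tree onto the edge from [r] to [ch r], moving [ch (ch r)]. This serves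
    the lower bound. *)
Lemma nontrivial_endomorphism : exists2 phi, endomorphism T phi & ~ phi =1 id.
Proof.
exists (fun v => if odd (h v) then ch r else r) => [u v|].
  wlog [vr <-] : u v / v != r /\ par v = u => [H|_].
    move=> /[dup] uv; rewrite (adj_parentE R) => /orP[] /andP[] ? /eqP ?.
      exact: H uv.
    by rewrite adj_sym; apply: H; rewrite // adj_sym.
  rewrite [h v](depth_parent R) //=; have := adj_child r.
  by case: odd => //; rewrite adj_sym.
move=> /(_ (ch (ch r))); rewrite !depth_child depth_root /= => e.
by have := congr1 h e; rewrite !depth_child depth_root.
Qed.

Variable w : nat -> V.
Hypothesis w_phase : forall i, h (w i) %% 8 = 6.
Hypothesis w_gap : forall i, h (w i) + i < h (w i.+1).
Hypothesis w_below : forall v, exists i n, iter n par (w i) = v.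

Definition vertex_type v : nat * bool := (h v %% 8, `[< exists i, v = w i >]).

Lemma vertex_type_in v : vertex_type v \in types.
Proof.
rewrite /vertex_type; case: asboolP => [[i ->]|_]; first by rewrite w_phase.
have: h v %% 8 < 8 by rewrite ltn_pmod.
by move: (h v %% 8); do 8?case=> //.
Qed.

Lemma below_parent v : v != r -> below (vertex_type (par v)) (vertex_type v).
Proof. by move=> vr; rewrite /below /= (depth_parent R v) // -(addn1 (h _)) -(addn1 (_ %% _)) modnDml. Qed.

Lemma w_depth_homo i j : i < j -> h (w i) + i < h (w j).
Proof.
elim: j => // j IHj; rewrite ltnS leq_eqVlt => /orP[/eqP->//|/IHj lt].
by apply: (leq_trans lt); apply: ltnW; apply: leq_ltn_trans (w_gap j); apply: leq_addr.
Qed.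

Lemma w_depth_inj i j : h (w i) = h (w j) -> i = j.
Proof.
by move=> e; case: (ltngtP i j) => // /w_depth_homo; rewrite e ltnNge leq_addr.
Qed.

Section Preserved.
Variable phi : V -> V.
Hypothesis phi_endo : endomorphism T phi.
Hypothesis phi_color : preserves phi (type_color \o vertex_type).

Lemma phi_parent_or v : v != r ->
  phi v != r /\ par (phi v) = phi (par v) \/
  phi (par v) != r /\ par (phi (par v)) = phi v.
Proof.
move=> vr; have := phi_endo (par v) v; rewrite !(adj_parentE R) vr eqxx /=.
by move=> /(_ isT) /orP[] /andP[-> /eqP ->]; [left|right].
Qed.

(** Every vertex has a child, and the pair at [ch v] witnesses that the pair at [v] survives the
    next round. *)
Lemma phi_viable n v : (vertex_type v, vertex_type (phi v)) \in viable n.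
Proof.
elim: n v => [|n IHn] v.
  rewrite mem_filter; apply/andP; split; first exact/eqP/esym/phi_color.
  by apply/allpairsP; exists (vertex_type v, vertex_type (phi v)); split => //;
     apply: vertex_type_in.
rewrite mem_filter IHn andbT; apply/hasP.
exists (vertex_type (ch v), vertex_type (phi (ch v))); first exact: IHn.
have [chr chv] := chP v.
have := below_parent _ chr; rewrite chv /= => ->.
have := phi_parent_or _ chr; rewrite chv.
by case=> -[/below_parent + e]; rewrite e => ->; rewrite ?orbT.
Qed.

(** Both claims go together down the tree: phase agreement at [par v] excludes a turn at [v], and
    without a turn the agreement passes to [v]. *)
Lemma phi_phase_parent v :
  h (phi v) = h v %[mod 8] /\
  (v != r -> phi v != r /\ par (phi v) = phi (par v)).
Proof.
elim/depth_ind: v => [|v vr [IHv _]].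
  have /allP /(_ _ (phi_viable 11 r)) := viable_root.
  by rewrite /= depth_root /= => /eqP ->; rewrite eqxx.
case: (phi_parent_or _ vr) => -[ne e].
  split; last by [].
  move: (below_parent _ vr) (below_parent _ ne) => /eqP /= -> /eqP /= ->.
  by rewrite e IHv.
have /allP /(_ _ (phi_viable 11 (par v))) /allP /(_ _ (phi_viable 11 v)) := viable_no_turn.
by rewrite /= below_parent // -e below_parent // e IHv eqxx.
Qed.

Lemma phi_parent v : v != r -> par (phi v) = phi (par v).
Proof. by move=> vr; have [_ /(_ vr)[]] := phi_phase_parent v. Qed.

Lemma depth_phi v : h (phi v) = h v + h (phi r).
Proof.
elim/depth_ind: v => [|v vr IHv]; first by rewrite depth_root.
have [_ /(_ vr)[phir e]] := phi_phase_parent v.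
by rewrite (depth_parent R) // e IHv (depth_parent R v).
Qed.

Lemma phi_marked i : exists j, phi (w i) = w j.
Proof.
have e : vertex_type (phi (w i)) = vertex_type (w i).
  apply: types_color_inj; rewrite ?vertex_type_in //; last exact: phi_color.
  by have [] := phi_phase_parent (w i).
by apply/asboolP; have := congr1 snd e; rewrite /= => ->; apply/asboolP; exists i.
Qed.

Lemma phi_root : phi r = r.
Proof.
apply/eqP; rewrite -(depth_eq0 R); apply/negPn/negP; rewrite -lt0n => t0.
(* The index is the shift itself: below [w i] the next mark is more than [i] levels deeper, so a
   positive shift by [i] cannot take [w i] to a mark. *)
have [j wj] := phi_marked (h (phi r)).
have := depth_phi (w (h (phi r))); rewrite wj => hj.
have [/w_depth_homo|/w_depth_homo|jE] := ltngtP j (h (phi r)).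
- by rewrite hj ltnNge -addnA leq_addr.
- by rewrite hj ltnn.
by move: t0; rewrite lt0n -(eqn_add2l (h (w j))) addn0 {1}jE -hj eqxx.
Qed.

Lemma phi_id : phi =1 id.
Proof.
move=> v; have [i [n <-]] := w_below v.
have par_phi u : par (phi u) = phi (par u).
  by have [->|/phi_parent//] := eqVneq u r; rewrite phi_root (parent_root R) phi_root.
elim: n => [|n IHn] /=; last by rewrite -par_phi IHn.
(* The image of a mark is a mark at the same depth, and a level carries at most one. *)
have [j wj] := phi_marked i; rewrite wj; congr w; apply/esym/w_depth_inj.
by rewrite -wj depth_phi phi_root depth_root addn0.
Qed.

End Preserved.
End LevelColoring.

(** * Placing the marks, and the theorem *)

Lemma marks_exist (V : eqType) (T : sgraph V) (r : V) (R : rooting T r) (ch : V -> V) :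
  countable [set: V] -> (forall v, ch v != r /\ parent R (ch v) = v) ->
  exists w : nat -> V,
    [/\ forall i, depth R (w i) %% 8 = 6,
        forall i, depth R (w i) + i < depth R (w i.+1) &
        forall v, exists i n, iter n (parent R) (w i) = v].
Proof.
move=> /countable_injP[f finj] chP.
have /choice[e eP] : forall n, exists v, (exists u, f u = n) -> f v = n.
  by move=> n; have [[u fu]|no] := pselect (exists u, f u = n); [exists u|exists r].
have e_f v : e (f v) = v.
  by apply: finj; rewrite ?inE //; apply: eP; exists v.
(* The form [8 * _ + 6] fixes the phase, [level j + j] secures the gap, and the depth of [e i]
   leaves room to descend from [e i] to this level. *)
pose fix level i := 8 * ((if i is j.+1 then level j + j else 0) + depth R (e i)) + 6.
have levelE i : level i.+1 = 8 * (level i + i + depth R (e i.+1)) + 6 by [].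
have level_ge i : depth R (e i) <= level i.
  case: i => [|i]; rewrite ?levelE /=; apply: leq_trans (leq_addr _ _).
    by rewrite add0n leq_pmull.
  by rewrite mulnDr; apply: leq_trans (leq_addl _ _); rewrite leq_pmull.
pose w i := iter (level i - depth R (e i)) ch (e i).
have wE i : depth R (w i) = level i.
  by rewrite /w (depth_iter_child _ _ _ _ _ chP) subnK.
exists w; split=> [i|i|v].
- by rewrite wE; case: i => [|i]; rewrite ?levelE /= mulnC modnMDl.
- rewrite !wE levelE addnS ltnS; apply: leq_trans (leq_addr _ _).
  by apply: leq_trans (leq_addr (depth R (e i.+1)) _) _; rewrite leq_pmull.
exists (f v), (level (f v) - depth R (e (f v))).
by rewrite /w (iter_parent_child _ _ _ _ _ chP) e_f.
Qed.

Theorem theorem15 (V : eqType) (T : sgraph V)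
  (hcount : countable [set: V]) (hinf : infinite_set [set: V])
  (htree : tree T)
  (hpend : is_subset1 [set v | pendant T v]) :
  De_eq T 'I_2.
Proof.
have [r [R [ch chP]]] := root_with_children V T hinf htree hpend.
split=> [|L [c cP]].
  have [w [w_phase w_gap w_below]] := marks_exist V T r R ch hcount chP.
  exists (fun v => inord (type_color (vertex_type V T r R w v)) : 'I_2).
  move=> phi phi_endo phi_color.
  apply: (phi_id V T r R ch chP w w_phase w_gap w_below phi phi_endo) => v.
  have := congr1 val (phi_color v); rewrite /= !inordK ?ltnS ?leq_b1 //.
  by do 2 case: type_color.
have [phi phi_endo phi_nid] := nontrivial_endomorphism V T r R ch chP.
(* A labeling preserved only by the identity changes along [phi] somewhere; the two labels there
   embed ['I_2] into [L]. *)
have [v cv] : exists v, c (phi v) <> c v.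
  by apply: contrapT => no; apply/phi_nid/cP => // v; apply: contrapT => cv; apply: no; exists v.
pose g (i : 'I_2) := if i == ord0 then c (phi v) else c v.
have g_inj : injective g.
  move=> i j; rewrite /g; case: (eqVneq i ord0) (eqVneq j ord0) => [->|i0] [->|j0] //.
    by move=> e; case: cv.
  by move=> _; apply: val_inj; case: i j i0 j0 => [[|[|//]] //= ?] [[|[|//]] //= ?].
rewrite -(card_le_eql (inj_card_eq (A := setT) (in2W g_inj))).
exact: subset_card_le.
Qed.
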